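(* If $\{X_j\}$ is a (strictly) stationary $\alpha$-mixing sequence of real random variables whose marginal distribution function $F(x)=\mathbb{P}(X_1\le x)$ is continuous, then $\{X_j\}$ admits a continuous phantom distribution function.
   Context: $M_n=\max_{1\le j\le n}X_j$. A distribution function $G$ is a phantom distribution function for the stationary sequence $\{X_j\}$ if $\sup_{u\in\mathbb{R}}|\mathbb{P}(M_n\le u)-G^n(u)|\to 0$ as $n\to\infty$, where $G^n(u)=(G(u))^n$. For $s\in\mathbb{N}$ let $\mathcal{M}^s$ be the family of all measurable non-constant functions $f:\mathbb{R}^s\to\mathbb{R}$ with $\sup|f|\le 1$. The $\alpha$-mixing coefficient is $$\alpha(r)=\sup\frac{\left|\mathrm{Cov}\left(f(X_{i_1},\dots,X_{i_s}),g(X_{j_1},\dots,X_{j_t})\right)\right|}{4},$$ the supremum being over all $s,t\in\mathbb{N}$, $f\in\mathcal{M}^s$, $g\in\mathcal{M}^t$ and all indices $i_1\le\cdots\le i_s\le j_1\le\cdots\le j_t$ with $j_1-i_s\ge r$. The sequence is $\alpha$-mixing if $\alpha(r)\to 0$ as $r\to\infty$. *)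

(* Defs.v *)
From HB Require Import structures.
From mathcomp Require Import all_boot all_order all_algebra.
From mathcomp Require Import all_classical all_reals all_analysis.

Set Implicit Arguments.
Unset Strict Implicit.
Unset Printing Implicit Defensive.

Import Order.TTheory GRing.Theory Num.Theory.
Import numFieldNormedType.Exports.

Local Open Scope classical_set_scope.
Local Open Scope ring_scope.

(* Sequences are indexed from 0: the term [X j] stands for $X_{j+1}$. *)

(* $(X_{i_1}, \dots, X_{i_s})$ *)
Definition sample d (T : measurableType d) (R : realType)
    (P : probability T R) (X : nat -> {RV P >-> R}) s (i : s.-tuple nat)
    (w : T) : s.-tuple R :=
  map_tuple (fun k => X k w) i.

Definition strictly_stationary d (T : measurableType d) (R : realType)
    (P : probability T R) (X : nat -> {RV P >-> R}) : Prop :=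
  forall s (i : s.-tuple nat) (h : nat) (A : set (s.-tuple R)),
    measurable A ->
    P (sample X (map_tuple (addn h) i) @^-1` A) = P (sample X i @^-1` A).

(* $\mathcal{M}^s$, with $\mathbb{R}^s$ carrying the product of the Borel
   sigma-algebras, which is the Borel sigma-algebra of $\mathbb{R}^s$ *)
Definition test_fun (R : realType) s : set (s.-tuple R -> R) :=
  [set f : s.-tuple R -> R | [/\ measurable_fun [set: s.-tuple R] f,
               exists x y, f x <> f y &
               forall x, `|f x| <= 1]].

(* The size is written [s.+1] since the index tuples are nonempty. *)
Definition alpha_coef d (T : measurableType d) (R : realType)
    (P : probability T R) (X : nat -> {RV P >-> R}) (r : nat) : \bar R :=
  ereal_sup [set c : \bar R | exists s t
    (f : s.+1.-tuple R -> R) (g : t.+1.-tuple R -> R)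
    (i : s.+1.-tuple nat) (j : t.+1.-tuple nat),
    [/\ test_fun f, test_fun g, sorted leq (i ++ j),
        (tnth i ord_max + r <= tnth j ord0)%N &
        c = (`|covariance P (f \o sample X i) (g \o sample X j)| / 4%:E)%E]].

Definition alpha_mixing d (T : measurableType d) (R : realType)
    (P : probability T R) (X : nat -> {RV P >-> R}) : Prop :=
  alpha_coef X r @[r --> \oo] --> 0%E.

(* $M_n$ for [n > 0]; the default value [X 0 w] is itself one of the terms then
   and so does not affect the maximum. *)
Definition partial_max d (T : measurableType d) (R : realType)
    (P : probability T R) (X : nat -> {RV P >-> R}) (n : nat) (w : T) : R :=
  \big[Num.max/X 0%N w]_(j < n) X j w.

Definition phantom_df d (T : measurableType d) (R : realType)
    (P : probability T R) (X : nat -> {RV P >-> R})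
    (G : cumulativeBounded (0 : R) (1 : R)) : Prop :=
  ereal_sup [set (`|P [set w | (partial_max X n w <= u)%R] - (G u ^+ n)%:E|)%E
            | u in [set: R]] @[n --> \oo] --> 0%E.

(* Main.v *)
(* Let a_u(n) be the probability that X_1, ..., X_n <= u. Mixing, together with
   deleting a gap of length r (which costs r P(X_1 > u)), shows that
   a_u(p + q) is close to a_u(p) a_u(q), uniformly in p and q, when u is close
   to the right end of F. A nonincreasing almost multiplicative sequence with
   a(1) close to 1 is uniformly close to any g^n which nearly agrees with it at
   a single m where a(m) is bounded away from 0 and 1.
   The phantom distribution function is G(u) = sup_n c(a_u(n))^(1/n) with the
   truncation c(p) = max(0, min(1/2, 2p - 1/2)). As c vanishes on [0, 1/4] and
   a_u(n) -> 0, this is locally a finite maximum of functions continuous in u;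
   as c(p) <= p, with equality for 0 < c(p) only at p = 1/2, the supremum is
   reached where a_u(m) is close to 1/2, and there a_u(m) is close to G(u)^m. *)

Require Import Defs.
From HB Require Import structures.
From mathcomp Require Import all_boot all_order all_algebra.
From mathcomp Require Import all_classical all_reals all_analysis.
From mathcomp Require Import ring lra zify.

Set Implicit Arguments.
Unset Strict Implicit.
Unset Printing Implicit Defensive.

Import Order.TTheory GRing.Theory Num.Theory.
Import numFieldNormedType.Exports.

Local Open Scope classical_set_scope.
Local Open Scope ring_scope.

(** * Almost multiplicative sequences and power inequalities *)

Record almost_geometric (R : realType) (eta : R) (a : nat -> R) : Prop := {
  ag_0 : a 0%N = 1;
  ag_ge0 : forall n, 0 <= a n;
  ag_noninc : forall m n, (m <= n)%N -> a n <= a m;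
  ag_mul : forall p q, `|a (p + q)%N - a p * a q| <= eta;
  ag_1 : 1 - a 1%N <= eta }.

Section AlmostGeometric.
Context {R : realType}.
Implicit Types (eta e g x y : R) (a : nat -> R).

Lemma ag_le1 eta a n : almost_geometric eta a -> a n <= 1.
Proof. by move=> H; rewrite -(ag_0 H); exact: ag_noninc H _ _ _. Qed.

Lemma ag_eta_ge0 eta a : almost_geometric eta a -> 0 <= eta.
Proof. by move=> H; apply: le_trans (ag_mul H 0 0). Qed.

(** One step loses at most [eta + eta]: the multiplicativity defect plus [a r * (1 - a 1)]. *)
Lemma ag_initial eta a r : almost_geometric eta a -> 1 - a r <= r%:R * (eta + eta).
Proof.
move=> H; elim: r => [|r IH]; first by rewrite (ag_0 H) subrr mul0r.
have := ag_mul H r 1; rewrite addn1 ler_norml => /andP[h _].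
have h1 := ag_1 H; have h2 := ag_le1 r H; have h3 := ag_ge0 H r.
have h4 : a r * (1 - a 1%N) <= eta.
  apply: le_trans h1; rewrite ler_piMl// subr_ge0; exact: ag_le1 H.
rewrite -natr1; lra.
Qed.

(** The defects add up linearly, since multiplying by [a k <= 1] does not amplify the error already
    made. *)
Lemma ag_iter eta a k j : almost_geometric eta a ->
  `|a (j * k)%N - a k ^+ j| <= j%:R * eta.
Proof.
move=> H; elim: j => [|j IH]; first by rewrite mul0n (ag_0 H) expr0 subrr normr0 mul0r.
have := ag_mul H k (j * k); rewrite -mulSn => h.
have -> : a (j.+1 * k)%N - a k ^+ j.+1 =
   (a (j.+1 * k)%N - a k * a (j * k)%N) + a k * (a (j * k)%N - a k ^+ j).
  by rewrite exprS; ring.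
rewrite (le_trans (ler_normD _ _))// -natr1 mulrDl mul1r addrC lerD//.
rewrite normrM (ger0_norm (ag_ge0 H k)); apply: le_trans IH.
by rewrite ler_piMl//; exact: ag_le1 H.
Qed.

Lemma bernoulli_le x n : 0 <= x -> x <= 1 -> 1 - x ^+ n <= n%:R * (1 - x).
Proof.
move=> x0 x1; elim: n => [|n IH]; first by rewrite expr0 subrr mul0r.
rewrite exprS -natr1.
have h : 0 <= x ^+ n <= 1 by rewrite exprn_ge0// exprn_ile1.
nra.
Qed.

(** Turns a lower bound on [x ^+ n] into an upper bound on [n (1 - x)]. With [z = 1 - x] and
    [k = n], the induction step rests on [(1 - z) (1 + (k + 1) z) = 1 + k z - (k + 1) z^2]. *)
Lemma bernoulli_inv x n : 0 <= x -> x <= 1 -> x ^+ n * (1 + n%:R * (1 - x)) <= 1.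
Proof.
move=> x0 x1; elim: n => [|n IH]; first by rewrite expr0 mul0r addr0 mulr1.
have h : 0 <= x ^+ n <= 1 by rewrite exprn_ge0// exprn_ile1.
have h2 : 0 <= (n%:R : R) by [].
apply: le_trans IH; rewrite exprS -mulrA mulrCA ler_wpM2l//; first by case/andP: h.
rewrite -natr1; set k := (n%:R : R) in h2 *; set z := 1 - x.
have -> : x = 1 - z by rewrite /z; ring.
have : 0 <= z * z * (k + 1) by rewrite mulr_ge0 ?mulr_ge0// ?subr_ge0// addr_ge0.
nra.
Qed.

Lemma expr_diff_le x y n : 0 <= x <= 1 -> 0 <= y <= 1 ->
  `|x ^+ n - y ^+ n| <= n%:R * `|x - y|.
Proof.
move=> /andP[x0 x1] /andP[y0 y1]; elim: n => [|n IH].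
  by rewrite !expr0 subrr normr0 mul0r.
have -> : x ^+ n.+1 - y ^+ n.+1 = x * (x ^+ n - y ^+ n) + (x - y) * y ^+ n.
  by rewrite !exprS; ring.
have -> : n.+1%:R * `|x - y| = n%:R * `|x - y| + `|x - y| by rewrite -natr1 mulrDl mul1r.
rewrite (le_trans (ler_normD _ _))// !normrM lerD//.
  by apply: le_trans IH; rewrite ler_piMl// ger0_norm.
by rewrite ler_piMr// ger0_norm ?exprn_ge0// exprn_ile1.
Qed.

(** For [y <= x] the difference of the powers is [x - y] times a sum of n products of n - 1 factors
    [x] or [y], each at least [y ^+ n >= c]. *)
Lemma expr_diff_ge c x y n : 0 <= c -> 0 <= x <= 1 -> 0 <= y <= 1 ->
  c <= x ^+ n -> c <= y ^+ n -> n%:R * c * `|x - y| <= `|x ^+ n - y ^+ n|.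
Proof.
move=> c0.
wlog xy : x y / y <= x.
  move=> W hx hy cx cy; have [yx|/ltW xy] := leP y x; first exact: W.
  by rewrite (distrC x) (distrC (x ^+ n)); exact: W.
move=> /andP[x0 x1] /andP[y0 y1] _ cy.
rewrite subrXX normrM mulrC ler_wpM2l// ger0_norm; last first.
  by apply: sumr_ge0 => i _; rewrite mulr_ge0// exprn_ge0.
have -> : n%:R * c = \sum_(i < n) c by rewrite sumr_const card_ord mulr_natl.
apply: ler_sum => i _; apply: le_trans cy _.
case: n i => [[]//|n i] /=.
have -> : y ^+ n.+1 = y * (y ^+ (n.+1 - i.+1) * y ^+ i).
  by rewrite -exprD -exprS subSS subnK// -ltnS.
apply: (@le_trans _ _ (y ^+ (n.+1 - i.+1) * y ^+ i)).
  by rewrite ler_piMl// mulr_ge0// exprn_ge0.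
by rewrite ler_pM ?exprn_ge0// lerXn2r.
Qed.


(** * Comparison of an almost geometric sequence with a geometric one *)

Section Comparison.
Context (eta g : R) (a : nat -> R) (m K : nat).
Hypotheses (aeta : almost_geometric eta a) (g01 : 0 <= g <= 1)
  (am : 1 / 4 <= a m <= 3 / 4) (agm : `|a m - g ^+ m| <= eta)
  (K0 : (0 < K)%N) (Keta : 61 * (K%:R * eta) <= 1 / 16).

(** The stretch of length [m] is cut into [K] pieces of length [k], up to a remainder below [K]. The
    multiples of [k] form the grid on which [a] and the powers of [g] are compared. *)
Let k := (m %/ K)%N.

Let eta_small : 0 <= eta <= 1 / 976.
Proof.
have h0 := ag_eta_ge0 aeta; rewrite h0 /=.
have : eta <= K%:R * eta by rewrite ler_peMl// ler1n.
move: Keta; lra.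
Qed.

Let gm : 1 / 8 <= g ^+ m <= 7 / 8.
Proof. by move: agm am eta_small; rewrite ler_norml; lra. Qed.

(** As [g ^+ m >= 1/8], Bernoulli gives [m (1 - g) <= 7]. As [a] falls by at least 1/4 within [m]
    steps of at most [2 eta], also [1/8 <= m eta]. *)
Let g_near1 : 1 - g <= 56 * eta.
Proof.
have [g0 g1] := andP g01.
have h1 := bernoulli_inv m g0 g1; have h2 := ag_initial m aeta.
have : 0 <= (m%:R : R) by [].
set M := (m%:R : R) in h1 h2 * => M0.
have h3 : M * (1 - g) <= 7.
  suff : (1 / 8) * (1 + M * (1 - g)) <= 1 by lra.
  apply: le_trans h1; rewrite ler_wpM2r//; last by case/andP: gm.
  by rewrite addr_ge0// mulr_ge0// subr_ge0.
have h4 : 1 / 8 <= M * eta by move: am; lra.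
have M1 : 0 < M by rewrite lt_neqAle M0 andbT; apply: contraTneq h4 => <-; lra.
rewrite -(ler_pM2l M1); lra.
Qed.

Let k_gt0 : (0 < k)%N.
Proof.
rewrite divn_gt0//; have h2 := ag_initial m aeta.
rewrite leqNgt; apply/negP => mK.
have : m%:R * eta <= K%:R * eta.
  by rewrite ler_wpM2r ?ler_nat ?(ltnW mK)//; exact: ag_eta_ge0 aeta.
move: am Keta; lra.
Qed.

(** The [K] pieces together keep a factor of at least 1/8, so a single piece loses at most [7 / K].
    This bounds the fall of [g ^+ n] between neighbouring grid points. *)
Lemma ag_coarse : 1 - g ^+ k <= 7 / K%:R.
Proof.
have [g0 g1] := andP g01.
have K1 : 0 < (K%:R : R) by rewrite ltr0n.
rewrite ler_pdivlMr// mulrC.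
have h1 : 1 / 8 <= (g ^+ k) ^+ K.
  rewrite -exprM; apply: le_trans (_ : g ^+ m <= _); first by case/andP: gm.
  by rewrite ler_wiXn2l// leq_divM.
have h2 := @bernoulli_inv (g ^+ k) K (exprn_ge0 _ g0) (exprn_ile1 _ g0 g1).
suff : (1 / 8) * (1 + K%:R * (1 - g ^+ k)) <= 1 by lra.
apply: le_trans h2; rewrite ler_wpM2r//.
by rewrite addr_ge0// mulr_ge0// subr_ge0 exprn_ile1.
Qed.

Let gkK_ub : g ^+ (k * K) <= g ^+ m + 56 * (K%:R * eta).
Proof.
have [g0 g1] := andP g01.
rewrite [in g ^+ m](divn_eq m K) -/k exprD -lerBlDl.
rewrite -[X in X - _]mulr1 -mulrBr.
apply: (@le_trans _ _ (1 - g ^+ (m %% K))).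
  by rewrite ler_piMl ?exprn_ile1// subr_ge0 exprn_ile1.
apply: le_trans (bernoulli_le _ g0 g1) _.
rewrite mulrCA ler_pM//; first by rewrite subr_ge0.
by rewrite ler_nat ltnW// ltn_pmod.
Qed.

Lemma ag_tail : g ^+ (k * K) <= 15 / 16.
Proof. by move: gkK_ub gm eta_small Keta; lra. Qed.

Let akK : `|a (k * K)%N - a m| <= (2 * K%:R + 1) * eta.
Proof.
have h : a m <= a (k * K)%N by apply: ag_noninc aeta _ _ _; exact: leq_divM.
rewrite ger0_norm ?subr_ge0//.
have h1 := ag_initial (m %% K) aeta.
have := ag_mul aeta (k * K) (m %% K); rewrite -(divn_eq m K) ler_norml => /andP[h2 _].
have h3 : (m %% K)%:R * (eta + eta) <= K%:R * (eta + eta).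
  rewrite ler_wpM2r ?addr_ge0 ?(ag_eta_ge0 aeta)//.
  by rewrite ler_nat ltnW// ltn_pmod.
have h4 := ag_le1 (k * K) aeta; have h5 := ag_ge0 aeta (k * K).
have h6 : a (k * K)%N * (1 - a (m %% K)%N) <= K%:R * (eta + eta).
  apply: le_trans h3; apply: le_trans h1; rewrite ler_piMl// subr_ge0.
  exact: ag_le1 aeta.
have h7 := ag_ge0 aeta (m %% K).
lra.
Qed.

(* [a k ^+ K] and [g ^+ (k * K)] agree up to [O(K eta)], and both stay away from
   0, so that extracting [K]-th roots gains a factor [K]. *)
Lemma ag_step : `|a k - g ^+ k| <= 976 * eta.
Proof.
have [g0 g1] := andP g01.
have K1 : 0 < (K%:R : R) by rewrite ltr0n.
(* The constant is 61 = 1 + 3 + 1 + 56, from [ag_iter], [akK], [agm] and [gkK_ub], using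
   [1 <= K]. *)
have h1 : `|a k ^+ K - (g ^+ k) ^+ K| <= 61 * (K%:R * eta).
  have := ag_iter k K aeta; rewrite mulnC => i1.
  have i2 := akK.
  have i3 : g ^+ m <= g ^+ (k * K) by rewrite ler_wiXn2l// leq_divM.
  have i4 := gkK_ub; have := ag_eta_ge0 aeta; have : (1 : R) <= K%:R by rewrite ler1n.
  rewrite -exprM; move: i1 i2 agm; rewrite !ler_norml.
  move=> /andP[? ?] /andP[? ?] /andP[? ?] ? ?.
  by apply/andP; split; nra.
have h2 : 1 / 8 <= (g ^+ k) ^+ K.
  rewrite -exprM; apply: le_trans (_ : g ^+ m <= _); first by case/andP: gm.
  by rewrite ler_wiXn2l// leq_divM.
have h3 : 1 / 16 <= a k ^+ K.
  by move: h1 h2 Keta; rewrite ler_norml; lra.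
have h4 : K%:R * (1 / 16) * `|a k - g ^+ k| <= `|a k ^+ K - (g ^+ k) ^+ K|.
  apply: expr_diff_ge => //.
  - by rewrite (ag_ge0 aeta) (ag_le1 _ aeta).
  - by rewrite exprn_ge0// exprn_ile1.
  - by apply: le_trans h2; lra.
by rewrite -(ler_pM2l K1); lra.
Qed.

Lemma ag_grid j : `|a (j * k)%N - g ^+ (j * k)| <= j%:R * (977 * eta).
Proof.
have [g0 g1] := andP g01.
have h1 := ag_iter k j aeta.
have h2 : `|a k ^+ j - (g ^+ k) ^+ j| <= j%:R * `|a k - g ^+ k|.
  apply: expr_diff_le; first by rewrite (ag_ge0 aeta) (ag_le1 _ aeta).
  by rewrite exprn_ge0// exprn_ile1.
have h3 : j%:R * `|a k - g ^+ k| <= j%:R * (976 * eta) by rewrite ler_wpM2l// ag_step.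
rewrite mulnC [in g ^+ _]exprM mulnC.
have -> : a (j * k)%N - g ^+ k ^+ j =
   (a (j * k)%N - a k ^+ j) + (a k ^+ j - g ^+ k ^+ j) by ring.
by apply: le_trans (ler_normD _ _) _; lra.
Qed.

(** Up to the grid point number [K * L], [ag_grid] and monotonicity between neighbouring grid points
    give the first two summands. Beyond it, both sequences are small: [g ^+ n] is at most
    [(15 / 16) ^+ L] by [ag_tail], and [a n] exceeds this by at most the grid error. *)
Lemma ag_close_bound L n : `|a n - g ^+ n| <=
  (K * L)%:R * (977 * eta) + 7 / K%:R + (15 / 16) ^+ L.
Proof.
have [g0 g1] := andP g01.
have e0 : 0 <= 977 * eta := mulr_ge0 (ler0n _ _) (ag_eta_ge0 aeta).
have p0 : 0 <= 7 / (K%:R : R) by rewrite divr_ge0.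
have t0 : 0 <= (15 / 16 : R) ^+ L by rewrite exprn_ge0.
set J := (K * L)%N.
have kk := ag_coarse.
have hj j : (j <= J)%N -> `|a (j * k)%N - g ^+ (j * k)| <= J%:R * (977 * eta).
  move=> jJ; apply: le_trans (ag_grid j) _.
  by apply: ler_wpM2r e0 _ _ _; rewrite ler_nat.
have [nJ|Jn] := ltnP (n %/ k) J.
  have n1 : (n %/ k * k <= n)%N by exact: leq_divM.
  have n2 : (n <= (n %/ k).+1 * k)%N by rewrite ltnW// ltn_ceil.
  have a1 := ag_noninc aeta n1; have a2 := ag_noninc aeta n2.
  have b1 : g ^+ n <= g ^+ (n %/ k * k) by rewrite ler_wiXn2l.
  have b2 : g ^+ ((n %/ k).+1 * k) <= g ^+ n by rewrite ler_wiXn2l.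
  have b3 : g ^+ (n %/ k * k) - g ^+ ((n %/ k).+1 * k) <= 7 / K%:R.
    apply: le_trans kk; rewrite mulSn exprD -[X in X - _]mul1r -mulrBl.
    by rewrite ler_piMr ?exprn_ile1// subr_ge0 exprn_ile1.
  move: (hj _ (ltnW nJ)) (hj _ nJ); rewrite !ler_norml; lra.
have n1 : (J * k <= n)%N by apply: leq_trans (leq_divM n k); rewrite leq_mul2r Jn orbT.
have a1 := ag_noninc aeta n1.
have b1 : g ^+ n <= g ^+ (J * k) by rewrite ler_wiXn2l.
have b2 : g ^+ (J * k) <= (15 / 16) ^+ L.
  have -> : (J * k = k * K * L)%N by rewrite /J mulnC mulnA.
  by rewrite exprM lerXn2r ?nnegrE ?exprn_ge0// ag_tail.
have a0 := ag_ge0 aeta n; have c0 : 0 <= g ^+ n by rewrite exprn_ge0.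
move: (hj _ (leqnn J)); rewrite !ler_norml; lra.
Qed.

End Comparison.

Lemma ag_close e : 0 < e -> exists2 eta, 0 < eta & forall a g m,
  almost_geometric eta a -> 0 <= g <= 1 -> 1 / 4 <= a m <= 3 / 4 ->
  `|a m - g ^+ m| <= eta -> forall n, `|a n - g ^+ n| <= e.
Proof.
move=> e0.
have [L Le] : exists L, (15 / 16 : R) ^+ L <= e / 3.
  have : (fun n => (15 / 16 : R) ^+ n) @ \oo --> 0 by apply: cvg_expr; rewrite ger0_norm; lra.
  move=> /cvgr0Pnorm_le /(_ (e / 3) (divr_gt0 e0 (ltr0n _ 3)))[L _ /(_ L (leqnn L))] /=.
  by move=> h; exists L; apply: le_trans h; exact: ler_norm.
pose K := (Num.bound (21 / e)).+1.
have K0 : 0 < (K%:R : R) by rewrite ltr0n.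
have Ke : 7 / K%:R <= e / 3.
  rewrite ler_pdivrMr// mulrC -ler_pdivrMr; last by lra.
  have -> : 7 / (e / 3) = 21 / e by field; rewrite gt_eqF.
  have := archi_boundP (ltW (divr_gt0 (ltr0n R 21) e0)).
  by move=> h; apply: ltW; apply: lt_le_trans h _; rewrite ler_nat.
(* [L] makes the tail small, [K] the mesh, and only then is [eta = 1 / D] chosen. The first summand
   of [D] brings the grid error below [e / 3]; the second, with 976 = 61 * 16, ensures
   [61 * (K * eta) <= 1 / 16]. *)
pose D : R := (K * L)%:R * 977 * 3 / e + 976 * K%:R.
have q0 : 0 <= (K * L)%:R * 977 * 3 / e.
  apply: divr_ge0 (ltW e0); apply: mulr_ge0 (ler0n _ 3).
  by apply: mulr_ge0 (ler0n _ 977); exact: ler0n.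
have D0 : 0 < D.
  by apply: ltr_wpDl q0 _; apply: mulr_gt0 K0; rewrite ltr0n.
exists D^-1; first by rewrite invr_gt0.
move=> a g m aD g01 am agm n.
have h1 : 61 * (K%:R * D^-1) <= 1 / 16.
  rewrite mulrA ler_pdivrMr; last exact: D0.
  rewrite /D; lra.
apply: le_trans (ag_close_bound aD g01 am agm (ltn0Sn _) h1 L n) _.
have h2 : (K * L)%:R * (977 * D^-1) <= e / 3.
  rewrite mulrA ler_pdivrMr; last exact: D0.
  rewrite [e / 3 * D]mulrC -ler_pdivrMr; last by lra.
  have -> : (K * L)%:R * 977 / (e / 3) = (K * L)%:R * 977 * 3 / e by field; rewrite gt_eqF.
  by rewrite lerDl; apply: mulr_ge0; exact: ler0n.
apply: le_trans (lerD (lerD h2 Ke) Le) _; lra.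
Qed.

End AlmostGeometric.

(** * The truncated geometric rate of a sequence *)

Definition clip (R : realType) (p : R) : R :=
  Num.max 0 (Num.min (1 / 2) (2 * p - 1 / 2)).

HB.lock Definition geom_rate (R : realType) (a : nat -> R) : R :=
  sup [set clip (a n.+1) `^ n.+1%:R^-1 | n in [set: nat]].
Canonical geom_rate_unlockable := Unlockable geom_rate.unlock.

Section GeometricRate.
Context {R : realType}.
Implicit Types (a b : nat -> R) (x p q e : R).

Lemma clip_ge0 p : 0 <= clip p.
Proof. by rewrite /clip le_max lexx. Qed.

Lemma clip_le_half p : clip p <= 1 / 2.
Proof. by rewrite /clip ge_max ge_min lexx andbT; lra. Qed.

Lemma clip_id_le p : 0 <= p -> clip p <= p.
Proof. by move=> p0; rewrite /clip ge_max p0 ge_min /=; apply/orP; lra. Qed.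

Lemma clip_eq0 p : p <= 1 / 4 -> clip p = 0.
Proof. by move=> ?; apply/max_idPl; rewrite ge_min; apply/orP; right; lra. Qed.

Lemma clip_eq_half p : 1 / 2 <= p -> clip p = 1 / 2.
Proof. by move=> ?; rewrite /clip min_l ?max_r; lra. Qed.

Lemma le_clip p q : p <= q -> clip p <= clip q.
Proof.
move=> pq; rewrite /clip ge_max le_max lexx/= le_max; apply/orP; right.
by rewrite le_min !ge_min lexx/=; apply/orP; right; lra.
Qed.

Lemma clip_lip p q : clip p <= clip q + 2 * `|p - q|.
Proof.
have n0 := normr_ge0 (p - q); have := ler_norm (p - q) => n1.
have c0 := clip_ge0 q; rewrite {1}/clip ge_max; apply/andP; split; first by lra.
rewrite ge_min; apply/orP.
have [h|h] := leP (1 / 2) (2 * q - 1 / 2); [left|right].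
  by rewrite /clip min_l// max_r; lra.
have : 2 * q - 1 / 2 <= clip q by rewrite /clip min_r ?(ltW h)// le_max lexx orbT.
lra.
Qed.

Lemma powR_rootK x n : 0 <= x -> (x `^ n.+1%:R^-1) ^+ n.+1 = x.
Proof.
by move=> x0; rewrite -powR_mulrn ?powR_ge0// -powRrM mulVf ?powRr1//.
Qed.

Let root_le a x n : 0 <= x -> clip (a n.+1) <= x ^+ n.+1 ->
  clip (a n.+1) `^ n.+1%:R^-1 <= x.
Proof.
move=> x0 h; rewrite -(@ler_pXn2r _ n.+1) ?nnegrE ?powR_ge0//.
by rewrite powR_rootK ?clip_ge0.
Qed.

Lemma geom_rate_le a x : 0 <= x ->
  (forall n, (0 < n)%N -> clip (a n) <= x ^+ n) -> geom_rate a <= x.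
Proof.
move=> x0 h; rewrite unlock; apply: ge_sup; first by exists (clip (a 1%N) `^ 1^-1); exists 0%N.
by move=> _ [n _ <-]; apply: root_le => //; exact: h.
Qed.

Let has_sup_rate a :
  has_sup [set clip (a n.+1) `^ n.+1%:R^-1 | n in [set: nat]].
Proof.
split; first by exists (clip (a 1%N) `^ 1^-1); exists 0%N.
exists 1 => _ [n _ <-]; apply: root_le => //; rewrite expr1n.
by apply: le_trans (clip_le_half _) _; lra.
Qed.

Let rate_ge_root a n : clip (a n.+1) `^ n.+1%:R^-1 <= geom_rate a.
Proof. by rewrite unlock; apply: ub_le_sup; [case: (has_sup_rate a)|exists n]. Qed.

Lemma geom_rate_ge0 a : 0 <= geom_rate a.
Proof. by apply: le_trans (rate_ge_root a 0); exact: powR_ge0. Qed.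

Lemma clip_le_rate a n : (0 < n)%N -> clip (a n) <= geom_rate a ^+ n.
Proof.
case: n => // n _; rewrite -[leLHS](powR_rootK n (clip_ge0 _)).
by rewrite lerXn2r ?nnegrE ?powR_ge0 ?geom_rate_ge0.
Qed.

Lemma geom_rate_le1 a : geom_rate a <= 1.
Proof.
apply: geom_rate_le => // n _; rewrite expr1n.
by apply: le_trans (clip_le_half _) _; lra.
Qed.

Lemma geom_rate_mono a b : (forall n, a n <= b n) -> geom_rate a <= geom_rate b.
Proof.
move=> ab; apply: geom_rate_le (geom_rate_ge0 _) _ => n n0.
by apply: le_trans (le_clip (ab n)) _; exact: clip_le_rate.
Qed.

Lemma expr_superadd x e n : 0 <= x -> 0 <= e -> (0 < n)%N ->
  x ^+ n + e ^+ n <= (x + e) ^+ n.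
Proof.
move=> x0 e0; elim: n => // -[|n] IH _; first by rewrite !expr1.
have := IH isT; rewrite 2![in X in X -> _]/= => h.
rewrite [leRHS]exprS; apply: le_trans (ler_wpM2l (addr_ge0 x0 e0) h).
have : 0 <= x * e ^+ n.+1 + e * x ^+ n.+1.
  by rewrite addr_ge0// mulr_ge0// exprn_ge0.
by rewrite (exprS x n.+1) (exprS e n.+1); lra.
Qed.

(** The n-th root is subadditive, by [expr_superadd], so an error [e ^+ n] under the n-th root costs
    at most [e], for all n at once. *)
Lemma geom_rate_perturb a b e : 0 <= e ->
  (forall n, (0 < n)%N -> clip (a n) <= clip (b n) + e ^+ n) ->
  geom_rate a <= geom_rate b + e.
Proof.
move=> e0 h; apply: geom_rate_le; first by rewrite addr_ge0 ?geom_rate_ge0.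
move=> n n0; apply: le_trans (h n n0) _.
apply: le_trans (expr_superadd (geom_rate_ge0 b) e0 n0).
by rewrite lerD2r clip_le_rate.
Qed.

(** The truncation kills every term from [N] on, so the supremum is a maximum over finitely many
    n. *)
Lemma geom_rate_attained a N : (forall n, (N <= n)%N -> a n <= 1 / 4) ->
  exists2 m, (0 < m)%N & clip (a m) = geom_rate a ^+ m.
Proof.
move=> aN; pose f (n : nat) := clip (a n.+1) `^ n.+1%:R^-1.
case: (@Order.TotalTheory.arg_maxP _ _ 'I_N.+1 ord0 xpredT (fun i => f (nat_of_ord i)) isT).
move=> m _ hm; exists m.+1 => //.
suff -> : geom_rate a = f m by rewrite powR_rootK// clip_ge0.
apply/eqP; rewrite eq_le rate_ge_root andbT.
rewrite unlock; apply: ge_sup; first by exists (clip (a 1%N) `^ 1^-1); exists 0%N.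
move=> _ [n _ <-]; have [nN|Nn] := ltnP n N.+1; first exact: (hm (Ordinal nN) isT).
rewrite clip_eq0; first by rewrite powR0 ?powR_ge0// invr_eq0 pnatr_eq0.
by apply: aN; rewrite (leq_trans (leqnSn N))// (leq_trans Nn).
Qed.

(** All roots are [(1/2)^(1/n)], which tend to 1 without reaching it. This is a case in which the
    supremum is not attained. *)
Lemma geom_rate_eq1 a : (forall n, 1 / 2 <= a n) -> geom_rate a = 1.
Proof.
move=> h; apply/eqP; rewrite eq_le geom_rate_le1 /= leNgt; apply/negP => g1.
have g0 := geom_rate_ge0 a.
have : (fun n => geom_rate a ^+ n) @ \oo --> 0 by apply: cvg_expr; rewrite ger0_norm.
have h4 : 0 < (1 / 4 : R) by lra.
move=> /cvgr0Pnorm_le /(_ _ h4)[L _ /(_ L.+1 (leqnSn L))] /=.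
rewrite ger0_norm ?exprn_ge0// => hL.
have := @clip_le_rate a L.+1 isT; rewrite clip_eq_half//; lra.
Qed.

Lemma almost_geometric_le eta eta' a : eta <= eta' ->
  almost_geometric eta a -> almost_geometric eta' a.
Proof.
move=> h [a0 ge0 ni mul a1]; split => //; last exact: le_trans h.
by move=> p q; apply: le_trans (mul p q) h.
Qed.

(* Let [a m0] be the last term above 1/2 and let [g ^+ m0 = 1/2], so that [a n]
   is close to [g ^+ n] and [g <= geom_rate a]. If [m] attains the supremum, then
   [a m <= g ^+ m + e1 <= geom_rate a ^+ m + e1 = clip (a m) + e1 <= a m + e1]. *)
Lemma geom_rate_close e : 0 < e -> exists2 eta, 0 < eta & forall a N,
  almost_geometric eta a -> (forall n, (N <= n)%N -> a n <= 1 / 4) ->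
  forall n, `|a n - geom_rate a ^+ n| <= e.
Proof.
(* [ag_close] is used twice. Its use with [g] gives accuracy [e1 <= eta2], which is the agreement at
   [m] needed for its use with [geom_rate a]. The bound [eta1 / 2] below reflects that [a m0] is
   only known to be within [2 eta] of 1/2. *)
move=> e0; have [eta2 eta20 H2] := @ag_close R e e0.
pose e1 := Num.min eta2 (1 / 8).
have e10 : 0 < e1 by rewrite lt_min eta20; lra.
have [eta1 eta10 H1] := @ag_close R e1 e10.
pose eta := Num.min eta2 (Num.min (eta1 / 2) (1 / 16)).
have [l1 l2 l3] : [/\ eta <= eta2, eta <= eta1 / 2 & eta <= 1 / 16].
  by split; rewrite /eta !ge_min lexx ?orbT.
have eta0 : 0 < eta by rewrite !lt_min eta20/=; lra.
have [k1 k2] : e1 <= eta2 /\ e1 <= 1 / 8 by split; rewrite /e1 !ge_min lexx ?orbT.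
exists eta => // a N aeta aN.
have [m0 m00 [b1 b2]] : exists2 m0, (0 < m0)%N & 1 / 2 <= a m0 /\ a m0.+1 < 1 / 2.
  have ex : exists n, a n < 1 / 2 by exists N; apply: le_lt_trans (aN N (leqnn N)) _; lra.
  case: (ex_minnP ex) => -[|[|m]] hm hmin.
  - by move: hm; rewrite (ag_0 aeta); lra.
  - by have := ag_1 aeta; lra.
  exists m.+1 => //; split => //; rewrite leNgt; apply/negP => /hmin.
  by rewrite ltnn.
have b3 : a m0 <= 1 / 2 + eta + eta.
  have := ag_mul aeta m0 1; rewrite addn1 ler_norml => /andP[h _].
  have h1 := ag_1 aeta; have h2 := ag_le1 m0 aeta; have h3 := ag_ge0 aeta m0.
  have h4 : a m0 * (1 - a 1%N) <= eta.
    by apply: le_trans h1; rewrite ler_piMl// subr_ge0; exact: ag_le1 aeta.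
  lra.
have [m mpos hm] := geom_rate_attained aN.
set G := geom_rate a in hm *.
have G0 : 0 <= G := geom_rate_ge0 a.
have G1 : G <= 1 := geom_rate_le1 a.
pose g := (1 / 2 : R) `^ m0.-1.+1%:R^-1.
have g0 : 0 < g by apply: powR_gt0; lra.
have gm0 : g ^+ m0 = 1 / 2.
  by rewrite -(prednK m00) /g powR_rootK//; lra.
have gG : g <= G.
  rewrite -(@ler_pXn2r _ m0)// ?nnegrE ?(ltW g0)// gm0 -(clip_eq_half b1).
  exact: clip_le_rate.
have A1 : almost_geometric eta1 a by apply: almost_geometric_le aeta; lra.
have A2 : almost_geometric eta2 a by apply: almost_geometric_le aeta; lra.
have close1 n : `|a n - g ^+ n| <= e1.
  apply: (H1 a g m0 A1) => //; first by rewrite (ltW g0) (le_trans gG).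
    by apply/andP; split; lra.
  by rewrite gm0 ler_norml; apply/andP; split; lra.
have c1 : a m <= G ^+ m + e1.
  have : g ^+ m <= G ^+ m by rewrite lerXn2r ?nnegrE ?(ltW g0).
  by move: (close1 m); rewrite ler_norml; lra.
have c2 : G ^+ m <= a m by rewrite -hm clip_id_le ?(ag_ge0 aeta).
have c3 : G ^+ m <= 1 / 2 by rewrite -hm clip_le_half.
(* The supremum cannot be attained where the truncation vanishes, because [G >= g > 0]. *)
have c4 : 1 / 4 < a m.
  rewrite ltNge; apply/negP => /clip_eq0; rewrite hm => /eqP.
  by rewrite expf_eq0 mpos/= gt_eqF// (lt_le_trans g0).
apply: (H2 a G m A2); first by rewrite G0.
  by apply/andP; split; lra.
by rewrite ler_norml; apply/andP; split; lra.
Qed.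

End GeometricRate.

(** * Real-valued probabilities and covariance of indicators *)

Section ProbabilityReal.
Context d (T : measurableType d) (R : realType) (P : probability T R).
Implicit Types A B C : set T.

Definition prob A : R := fine (P A).

Lemma probE A : measurable A -> P A = (prob A)%:E.
Proof. by move=> mA; rewrite fineK// fin_num_measure. Qed.

Lemma prob_ge0 A : 0 <= prob A. Proof. exact: fine_ge0. Qed.

Lemma prob_le A B : measurable A -> measurable B -> A `<=` B -> prob A <= prob B.
Proof. by move=> mA mB AB; rewrite -lee_fin -!probE// le_measure ?inE. Qed.

Lemma prob_setT : prob [set: T] = 1.
Proof. by rewrite /prob probability_setT. Qed.

Lemma prob_le1 A : measurable A -> prob A <= 1.
Proof. by move=> mA; rewrite -prob_setT; exact: prob_le. Qed.

Lemma prob_setU_le A B : measurable A -> measurable B ->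
  prob (A `|` B) <= prob A + prob B.
Proof.
move=> mA mB; rewrite -lee_fin EFinD -!probE//; first exact: measureU2.
exact: measurableU.
Qed.

Lemma prob_setD A B : measurable A -> measurable B -> A `<=` B ->
  prob (B `\` A) = prob B - prob A.
Proof.
move=> mA mB AB; apply: EFin_inj; rewrite EFinB -!probE//; last exact: measurableD.
rewrite measureD//; first by rewrite setIidr.
exact: le_lt_trans (probability_le1 P mB) (ltry _).
Qed.

(** A point of the larger intersection outside the smaller one lies in [A'] minus [A] or in [B']
    minus [B]. With [setT] as a larger set, this gives the cost of deleting a block. *)
Lemma prob_setI_diff A A' B B' :
  measurable A -> measurable A' -> measurable B -> measurable B' ->
  A `<=` A' -> B `<=` B' ->
  prob (A' `&` B') - prob (A `&` B) <= (prob A' - prob A) + (prob B' - prob B).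
Proof.
move=> mA mA' mB mB' AA' BB'.
rewrite -(prob_setD mA mA')// -(prob_setD mB mB')// lerBlDl.
have mI : measurable (A `&` B) by exact: measurableI.
have mDA : measurable (A' `\` A) by exact: measurableD.
have mDB : measurable (B' `\` B) by exact: measurableD.
apply: (@le_trans _ _ (prob ((A `&` B) `|` ((A' `\` A) `|` (B' `\` B))))).
  apply: prob_le; [exact: measurableI|by do !apply: measurableU|].
  move=> w [A'w B'w]; have [Aw|nAw] := pselect (A w); last by right; left.
  by have [Bw|nBw] := pselect (B w); [left|right; right].
apply: le_trans (prob_setU_le mI (measurableU _ _ mDA mDB)) _.
by rewrite lerD2l; exact: prob_setU_le.
Qed.

Lemma covariance_indic A B : measurable A -> measurable B ->
  covariance P (\1_A) (\1_B) = (prob (A `&` B) - prob A * prob B)%:E.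
Proof.
move=> mA mB.
have L C : measurable C -> (\1_C : T -> R) \in Lfun P 1.
  by move=> mC; apply/Lfun1_integrable; exact: integrable_indic.
have mI : measurable (A `&` B) by exact: measurableI.
have E : (\1_A * \1_B)%R = \1_(A `&` B) :> (T -> R) by rewrite indicI.
by rewrite covarianceE ?E ?L// !expectation_indic// !probE// EFinB EFinM.
Qed.

End ProbabilityReal.

(** * Non-exceedance probabilities of blocks under stationarity and mixing *)

Section Blocks.
Context d (T : measurableType d) (R : realType) (P : probability T R)
  (X : nat -> {RV P >-> R}).
Implicit Types (u v : R) (i h n m p q r : nat).

Definition box u n : set (n.-tuple R) := [set t | forall k, tnth t k <= u].
Arguments box : clear implicits.

Definition block u i n : set T :=
  [set w | forall j, (i <= j < i + n)%N -> X j w <= u].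

Lemma measurable_box u n : measurable (box u n).
Proof.
have -> : box u n = \bigcap_(k in [set: 'I_n])
     ((fun t : n.-tuple R => tnth t k) @^-1` `]-oo, u]).
  apply/seteqP; split=> t /= h k; first by move=> _ /=; rewrite in_itv/=; exact: h.
  by have := h k I; rewrite /= in_itv.
apply: fin_bigcap_measurable => // k _; rewrite -[X in measurable X]setTI.
exact: measurable_tnth.
Qed.

Lemma block_sample u i n : block u i n = sample X (iota_tuple n i) @^-1` box u n.
Proof.
have nE (k : 'I_n) : tnth (iota_tuple n i) k = (i + k)%N.
  by rewrite (tnth_nth 0%N) /= nth_iota.
apply/seteqP; split=> w /= h.
  by move=> k; rewrite tnth_map nE; apply: h; rewrite leq_addr ltn_add2l/=.
move=> j /andP[ij ji].
have jn : (j - i < n)%N by rewrite ltn_subLR.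
by have := h (Ordinal jn); rewrite tnth_map nE /= subnKC.
Qed.

Lemma measurable_sample n (t : n.-tuple nat) : measurable_fun setT (sample X t).
Proof.
apply/measurable_fun_tnthP => k.
rewrite (_ : _ \o _ = X (tnth t k) :> (T -> R))//.
by apply/funext => w /=; rewrite tnth_map.
Qed.

Lemma measurable_block u i n : measurable (block u i n).
Proof.
rewrite block_sample -[X in measurable X]setTI.
by apply: measurable_sample => //; exact: measurable_box.
Qed.
Hint Resolve measurable_block : core.

Lemma block0 u i : block u i 0 = setT.
Proof.
apply/seteqP; split => // w _ j; rewrite addn0 => /andP[ij ji].
by have := leq_ltn_trans ij ji; rewrite ltnn.
Qed.

Lemma blockD u i m n : block u i (m + n) = block u i m `&` block u (i + m) n.
Proof.
apply/seteqP; split=> w /= h.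
  split=> j /andP[ij ji]; apply: h.
    by rewrite ij (leq_trans ji)// addnA leq_addr.
  by rewrite (leq_trans _ ij) ?leq_addr//= addnA.
case: h => h1 h2 j /andP[ij ji].
have [jm|mj] := ltnP j (i + m); first by apply: h1; rewrite ij.
by apply: h2; rewrite mj -addnA.
Qed.

Lemma block_le u v i n : u <= v -> block u i n `<=` block v i n.
Proof. by move=> uv w h j ij; apply: le_trans uv; exact: h. Qed.

(* Equals 1 at [n = 0], whereas [partial_max X 0] is [X 0]. *)
Definition nexc u n : R := prob P (block u 0 n).

Lemma nexc0 u : nexc u 0 = 1.
Proof. by rewrite /nexc block0 prob_setT. Qed.

Lemma nexc_ge0 u n : 0 <= nexc u n. Proof. exact: prob_ge0. Qed.

Lemma nexc_le1 u n : nexc u n <= 1. Proof. exact: prob_le1. Qed.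

Lemma nexc_noninc u m n : (m <= n)%N -> nexc u n <= nexc u m.
Proof.
move=> mn; apply: prob_le => //.
by rewrite -(subnKC mn) blockD => w [].
Qed.

Lemma nexc_mono u v n : u <= v -> nexc u n <= nexc v n.
Proof. by move=> uv; apply: prob_le => //; exact: block_le. Qed.

Lemma partial_max_le u n : (0 < n)%N ->
  [set w | partial_max X n w <= u] = block u 0 n.
Proof.
move=> n0; apply/seteqP; split=> w /=; rewrite /partial_max.
  move=> h j /= jn; apply: le_trans h.
  by rewrite (le_trans _ (le_bigmax_cond _ _ (isT : xpredT (Ordinal jn))))//.
move=> h; apply: bigmax_le; first by apply: h.
by move=> j _; apply: h => /=.
Qed.

Lemma cdf_nexc u : fine (cdf (X 0%N) u) = nexc u 1.
Proof.
rewrite /nexc /prob /cdf /distribution/=; congr (fine (P _)).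
apply/seteqP; split=> w /=; rewrite in_itv/=; last by move=> h; apply: h.
by move=> h [|j].
Qed.

Hypothesis stat : strictly_stationary X.

Lemma prob_block u i n : prob P (block u i n) = nexc u n.
Proof.
rewrite /nexc /prob !block_sample -(stat (iota_tuple n 0) i (@measurable_box u n)).
suff -> : map_tuple (addn i) (iota_tuple n 0) = iota_tuple n i by [].
by apply/val_inj; rewrite /= -iotaDl addn0.
Qed.

(** Each of the n indices contributes at most the increment of the marginal distribution function,
    whose continuity thus passes to [nexc u n] as a function of [u]. *)
Lemma nexc_lip u v n : u <= v -> nexc v n - nexc u n <= n%:R * (nexc v 1 - nexc u 1).
Proof.
move=> uv; elim: n => [|n IH]; first by rewrite !nexc0 subrr mul0r.
have := @prob_setI_diff _ _ _ P (block u 0 n) (block v 0 n) (block u n 1) (block v n 1)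
 (measurable_block _ _ _) (measurable_block _ _ _)
 (measurable_block _ _ _) (measurable_block _ _ _)
 (block_le uv) (block_le uv).
by rewrite -!(blockD _ 0 n 1) addn1 !prob_block -natr1; lra.
Qed.

Lemma nexc_lip_norm u v n : `|nexc v n - nexc u n| <= n%:R * `|nexc v 1 - nexc u 1|.
Proof.
wlog uv : u v / u <= v.
  move=> W; have [/W//|/ltW/W] := leP u v.
  by rewrite (distrC (nexc v n)) (distrC (nexc v 1)).
by rewrite !ger0_norm ?subr_ge0 ?nexc_mono//; exact: nexc_lip.
Qed.

Lemma nexc_ge u r : 1 - nexc u r <= r%:R * (1 - nexc u 1).
Proof.
elim: r => [|n IH]; first by rewrite !nexc0 subrr mul0r.
have := @prob_setI_diff _ _ _ P (block u 0 n) setT (block u n 1) setT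
 (measurable_block _ _ _) measurableT (measurable_block _ _ _) measurableT
 (@subsetT _ _) (@subsetT _ _).
by rewrite -!(blockD _ 0 n 1) addn1 setTI prob_setT !prob_block -natr1; lra.
Qed.

Hypothesis mix : alpha_mixing X.

Lemma test_box u n : test_fun (\1_(box u n.+1) : _ -> R).
Proof.
split.
- by apply: measurable_realfun.measurable_indic; exact: measurable_box.
(* Test functions must be non-constant: the two constant tuples lie inside and outside the box,
   which requires positive length. *)
- exists (nseq_tuple n.+1 u), (nseq_tuple n.+1 (u + 1)).
  rewrite !indicE.
  have -> : nseq_tuple n.+1 u \in box u n.+1 by apply/mem_set => k; rewrite tnth_nseq.
  have -> : (nseq_tuple n.+1 (u + 1) \in box u n.+1) = false.
    by apply: memNset => /(_ (@ord0 n)); rewrite tnth_nseq; lra.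
  by apply/eqP; rewrite oner_eq0.
- by move=> x; rewrite indicE; case: (_ \in _) => /=; rewrite ?normr1 ?normr0.
Qed.

(** One [r] serves all [u], [p] and [q], because [alpha_coef] is a supremum over all test functions,
    among them the indicators of boxes. *)
Lemma mixing_gap e : 0 < e -> exists r, forall u p q,
  `|prob P (block u 0 p `&` block u (p + r) q) - nexc u p * nexc u q| <= e.
Proof.
move=> e0.
have [r hr] : exists r, (alpha_coef X r < (e / 4)%:E)%E.
  have e4 : 0 < e / 4 by lra.
  move: mix => /(_ [set x | (x < (e / 4)%:E)%E]) [].
    by apply: open_nbhs_nbhs; split; [exact: open_ereal_lt_ereal|rewrite /= lte_fin].
  by move=> N _ /(_ N (leqnn N)) h; exists N.
(* Empty blocks are treated apart, since the index tuples in [alpha_coef] are nonempty. *)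
exists r => u [|p] q.
  by rewrite block0 setTI prob_block nexc0 mul1r subrr normr0 ltW.
case: q => [|q].
  by rewrite block0 setIT prob_block nexc0 mulr1 subrr normr0 ltW.
set A := block u 0 p.+1; set B := block u (p.+1 + r) q.+1.
have := covariance_indic P (measurable_block u 0 p.+1) (measurable_block u (p.+1 + r) q.+1).
rewrite -/A -/B !prob_block => cE.
suff : (`|(prob P (A `&` B) - nexc u p.+1 * nexc u q.+1)%:E| / 4%:E <= alpha_coef X r)%E.
  move=> /le_lt_trans/(_ hr); rewrite abse_EFin inver pnatr_eq0/= -EFinM lte_fin.
  by rewrite ltr_pM2r ?invr_gt0// => /ltW.
apply: ereal_sup_ubound.
exists p, q, (\1_(box u p.+1)), (\1_(box u q.+1)),
  (iota_tuple p.+1 0), (iota_tuple q.+1 (p.+1 + r)).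
split; [exact: test_box|exact: test_box| | |].
- apply: (@subseq_sorted _ _ leq_trans _ (iota 0 (p.+1 + (r + q.+1))));
    last exact: iota_sorted.
  rewrite (iotaD 0 p.+1) cat_subseq// ?subseq_refl// add0n iotaD.
  exact: suffix_subseq.
- by rewrite !(tnth_nth 0%N) !nth_iota//= ?addn0 ?add0n; lia.
- rewrite -cE; congr (`|covariance P _ _| / _)%E.
    by rewrite /A block_sample.
  by rewrite /B block_sample.
Qed.

(** For [q > r], delete the first [r] indices of the second block, apply [mixing_gap], and replace
    [nexc u (q - r)] by [nexc u q]; the deletion and the replacement each cost at most
    [r (1 - nexc u 1)]. For [q <= r] there is no room for a gap, but both terms are within that cost
    of [nexc u p]. *)
Lemma nexc_mul e : 0 < e -> exists r, forall u p q,
  `|nexc u (p + q) - nexc u p * nexc u q| <= 2 * r%:R * (1 - nexc u 1) + e.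
Proof.
move=> e0; have [r hr] := mixing_gap e0; exists r => u p q.
have F0 : 0 <= 1 - nexc u 1 by rewrite subr_ge0 nexc_le1.
have key s : (s <= r)%N -> 1 - nexc u s <= r%:R * (1 - nexc u 1).
  move=> sr; apply: le_trans (nexc_ge u s) _.
  by rewrite ler_wpM2r// ler_nat.
have gap i j n m : prob P (block u i n `&` block u j m) -
    prob P (block u i n `&` block u j m `&` block u p r) <= 1 - nexc u r.
  have := @prob_setI_diff _ _ _ P (block u i n `&` block u j m)
    (block u i n `&` block u j m) (block u p r) setT.
  rewrite setIT prob_setT prob_block subrr add0r; apply => //; exact: measurableI.
have p1 := nexc_le1 u p; have p0 := nexc_ge0 u p.
have [qr|rq] := leqP q r.
  have k := key _ qr.
  have c1 := nexc_noninc u (leq_addr q p).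
  have c2 : nexc u p - nexc u (p + q) <= 1 - nexc u q.
    have := @prob_setI_diff _ _ _ P (block u 0 p) (block u 0 p) (block u p q) setT
      (measurable_block _ _ _) (measurable_block _ _ _) (measurable_block _ _ _) measurableT
      (@subset_refl _ _) (@subsetT _ _).
    by rewrite -(blockD u 0 p q) setIT prob_setT !prob_block subrr add0r.
  have q0 : 0 <= 1 - nexc u q by rewrite subr_ge0 nexc_le1.
  have c3 : 0 <= nexc u p * (1 - nexc u q) by rewrite mulr_ge0.
  have c4 : nexc u p * (1 - nexc u q) <= 1 - nexc u q by rewrite ler_piMl.
  by rewrite ler_norml; apply/andP; split; lra.
have k := key _ (leqnn r).
have := hr u p (q - r)%N; set J := prob P _ => hJ.
have c1 : nexc u (p + q) <= J.
  apply: prob_le => //; first exact: measurableI.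
  rewrite -{1}(subnKC (ltnW rq)) blockD add0n => w [w1 w2]; split => //.
  by move: w2; rewrite blockD => -[].
have c2 : J - nexc u (p + q) <= 1 - nexc u r.
  apply: le_trans (gap 0%N (p + r)%N p (q - r)%N); rewrite lerD2l lerN2 le_eqVlt.
  apply/orP; left; apply/eqP; rewrite /nexc; congr prob.
  by rewrite -{2}(subnKC (ltnW rq)) blockD add0n blockD -setIA [X in _ `&` X]setIC.
have c3 : 0 <= nexc u (q - r) - nexc u q <= 1 - nexc u r.
  rewrite subr_ge0 nexc_noninc ?leq_subr//=.
  have := @prob_setI_diff _ _ _ P (block u 0 r) setT (block u r (q - r)) (block u r (q - r))
      (measurable_block _ _ _) measurableT (measurable_block _ _ _) (measurable_block _ _ _)
      (@subsetT _ _) (@subset_refl _ _).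
  by rewrite -(blockD u 0 r) setTI prob_setT !prob_block subrr addr0 subnKC// ltnW.
have c4 : 0 <= nexc u p * (nexc u (q - r) - nexc u q) <= 1 - nexc u r.
  move/andP: c3 => [h1 h2]; rewrite mulr_ge0//=.
  by apply: le_trans h2; rewrite ler_piMl.
move: hJ c4; rewrite !ler_norml => /andP[h1 h2] /andP[h3 h4].
by apply/andP; split; lra.
Qed.

(** Separating the first variable from a far block by a gap shows that the limit [l] satisfies
    [l <= nexc u 1 * l + 2 e'] for small [e'], which forces [l = 0]. *)
Lemma nexc_to0 u : nexc u 1 < 1 -> forall e, 0 < e ->
  exists N, forall n, (N <= n)%N -> nexc u n <= e.
Proof.
move=> F1 e e0.
pose l := inf [set nexc u n | n in [set: nat]].
have hi : has_inf [set nexc u n | n in [set: nat]].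
  by split; [exists (nexc u 0); exists 0%N|exists 0 => _ [n _ <-]; exact: nexc_ge0].
have ln n : l <= nexc u n by apply: ge_inf; [case: hi|exists n].
suff l0 : l <= 0.
  have [_ [N _ <-] hN] := inf_adherent e0 hi.
  exists N => n Nn; apply: le_trans (nexc_noninc u Nn) _.
  by apply: le_trans (ltW hN) _; rewrite gerDr.
rewrite leNgt; apply/negP => lpos.
pose e' := l * (1 - nexc u 1) / 4.
have e'0 : 0 < e' by rewrite divr_gt0// mulr_gt0// subr_gt0.
have [r hr] := mixing_gap e'0.
have [_ [N _ <-] hN] := inf_adherent e'0 hi.
have := hr u 1%N N; have := ln (1 + (r + N))%N.
have : nexc u (1 + (r + N)) <= prob P (block u 0 1 `&` block u (1 + r) N).
  apply: prob_le => //; first exact: measurableI.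
  rewrite blockD blockD => w [w1 [_ w2]]; split => //.
rewrite ler_norml => h1 h2 /andP[_ h3].
have h4 : nexc u 1 * nexc u N <= nexc u 1 * (l + e').
  by rewrite ler_wpM2l ?nexc_ge0// ltW.
have h5 : nexc u 1 * e' <= e' by rewrite ler_piMl ?nexc_le1// ltW.
have h6 : 4 * e' = l * (1 - nexc u 1) by rewrite /e'; field.
lra.
Qed.

End Blocks.

(** * The phantom distribution function *)

Section Phantom.
Context d (T : measurableType d) (R : realType) (P : probability T R)
  (X : nat -> {RV P >-> R}).
Hypotheses (stat : strictly_stationary X) (mix : alpha_mixing X)
  (cont : continuous (fun x : R => fine (cdf (X 0%N) x))).
Implicit Types u e : R.

Definition phantom u : R := geom_rate (nexc X u).

Let F u := nexc X u 1.

Let continuous_F : continuous F.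
Proof.
rewrite (_ : F = fun x => fine (cdf (X 0%N) x)) //.
by apply/funext => u; rewrite cdf_nexc.
Qed.

Let F_le u v : u <= v -> F u <= F v. Proof. exact: nexc_mono. Qed.

Let F_pinfty : F x @[x --> +oo] --> (1 : R).
Proof.
rewrite (_ : F = fine \o cdf (X 0%N)); last by apply/funext => u; rewrite /= cdf_nexc.
exact/(fine_cvg (cvg_cdfy1 (X 0%N))).
Qed.

Let F_ninfty : F x @[x --> -oo] --> (0 : R).
Proof.
rewrite (_ : F = fine \o cdf (X 0%N)); last by apply/funext => u; rewrite /= cdf_nexc.
exact/(fine_cvg (cvg_cdfNy0 (X 0%N))).
Qed.

Lemma phantom_nondecreasing : nondecreasing phantom.
Proof. by move=> u v uv; apply: geom_rate_mono => n; exact: nexc_mono. Qed.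

(** If [F u] is close to 1, then [nexc X u L.+1 >= 1/2], hence [phantom u ^+ L.+1 >= 1/2], whereas
    the same power of [1 - e], cut off at 0, is at most 1/4. *)
Lemma phantom_near1 e : 0 < e ->
  exists2 delta, 0 < delta & forall u, 1 - F u <= delta -> 1 - e <= phantom u.
Proof.
move=> e0; pose x : R := Num.max 0 (1 - e).
have x0 : 0 <= x by rewrite le_max lexx.
have x1 : x < 1 by rewrite gt_max ltr01/=; lra.
have : (fun n => x ^+ n) @ \oo --> 0 by apply: cvg_expr; rewrite ger0_norm.
have h4 : 0 < (1 / 4 : R) by lra.
move=> /cvgr0Pnorm_le /(_ _ h4)[L _ /(_ L.+1 (leqnSn L))] /=.
rewrite ger0_norm ?exprn_ge0// => hL.
have L0 : 0 < (L.+1%:R : R) by [].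
exists (L.+1%:R^-1 / 2); first by rewrite divr_gt0// invr_gt0.
move=> u hu; rewrite leNgt; apply/negP => gu.
have h1 : 1 / 2 <= nexc X u L.+1.
  have := nexc_ge stat u L.+1.
  have : L.+1%:R * (1 - nexc X u 1) <= 1 / 2.
    have -> : 1 / 2 = L.+1%:R * (L.+1%:R^-1 / 2) :> R by rewrite mulrA divff// gt_eqF.
    by rewrite ler_wpM2l// ltW.
  lra.
have := @clip_le_rate _ (nexc X u) L.+1 isT; rewrite clip_eq_half// -/(phantom u).
have : phantom u ^+ L.+1 <= x ^+ L.+1.
  rewrite lerXn2r ?nnegrE ?geom_rate_ge0// le_max; apply/orP; right; exact: ltW.
lra.
Qed.

Lemma continuous_phantom : continuous phantom.
Proof.
move=> x; apply/cvgrPdist_le => /= e e0.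
(* Where [F x = 1] the maximum is not locally finite; there [phantom_near1] keeps both values within
   [e] of 1. *)
have [F1|F1] := ltP (F x) 1; last first.
  have [delta d0 hd] := phantom_near1 e0.
  have Fx : F x = 1 by apply/eqP; rewrite eq_le F1 nexc_le1.
  have px : phantom x <= 1 by exact: geom_rate_le1.
  move/cvgrPdist_le : (continuous_F (x := x)) => /(_ _ d0); apply: filterS => y.
  rewrite Fx => hy; have /hd h := le_trans (ler_norm _) hy.
  have /hd h' : 1 - F x <= delta by rewrite Fx subrr ltW.
  have py : phantom y <= 1 by exact: geom_rate_le1.
  by rewrite ler_norml; apply/andP; split; lra.
(* A level to the right of [x] yields one [N] beyond which the truncation vanishes for every
   [y <= u1]. *)
have [u1 xu1 Fu1] : exists2 u1, x < u1 & F u1 < 1.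
  have : \forall y \near x, F y < 1 by exact: (cvgr_lt (F x) (continuous_F (x := x))).
  move=> /nbhs_ballP[r /= r0 hr]; exists (x + r / 2); first by rewrite ltrDl divr_gt0.
  apply: hr; rewrite /ball/= opprD addrA subrr add0r normrN gtr0_norm ?divr_gt0//.
  by rewrite ltr_pdivrMr// ltr_pMr// ltr1n.
have q0 : 0 < (1 / 4 : R) by lra.
have [N hN] := nexc_to0 stat mix Fu1 q0.
pose e' := Num.min e 1.
have e'0 : 0 < e' by rewrite lt_min e0 ltr01.
(* The 2 is the Lipschitz constant of [clip] and [N] bounds that of [nexc]; the added 1 covers
   [N = 0]. As [e' <= 1], [e' ^+ N] is below every [e' ^+ n] with [n < N]. *)
pose delta := e' ^+ N / (2 * N%:R + 1).
have D0 : 0 < 2 * N%:R + 1 :> R by rewrite ltr_wpDl// mulr_ge0.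
have d0 : 0 < delta by rewrite divr_gt0// exprn_gt0.
have key y z : y <= u1 -> z <= u1 -> `|F y - F z| <= delta -> phantom y <= phantom z + e'.
  move=> yu zu yz; apply: geom_rate_perturb; first exact: ltW.
  move=> n n0; have [nN|Nn] := ltnP n N; last first.
    rewrite clip_eq0; first by rewrite addr_ge0 ?clip_ge0// exprn_ge0// ltW.
    by apply: le_trans (hN n Nn); exact: nexc_mono.
  apply: le_trans (clip_lip _ (nexc X z n)) _; rewrite lerD2l.
  have h1 := nexc_lip_norm stat z y n.
  have h2 : n%:R * `|nexc X y 1 - nexc X z 1| <= N%:R * delta.
    by rewrite ler_pM ?ler_nat// ltnW.
  have h3 : (2 * N%:R + 1) * delta = e' ^+ N.
    by rewrite /delta mulrC divfK// gt_eqF.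
  have h4 : e' ^+ N <= e' ^+ n.
    by rewrite ler_wiXn2l ?(ltW e'0)// ?ge_min ?lexx ?orbT// ltnW.
  lra.
have e'e : e' <= e by rewrite ge_min lexx.
have near1 : \forall y \near x, y <= u1.
  by near do apply: ltW; exact: lt_nbhsl.
have near2 : \forall y \near x, `|F x - F y| <= delta.
  by move/cvgrPdist_le : (continuous_F (x := x)) => /(_ _ d0).
apply: filterS2 near1 near2 => y yu1 xy.
have k1 := key _ _ (ltW xu1) yu1 xy.
have k2 : phantom y <= phantom x + e' by apply: key => //; [exact: ltW|rewrite distrC].
by rewrite ler_norml; apply/andP; split; lra.
Unshelve. all: by end_near. Qed.

(** Where [F y <= 1/4] all truncated terms vanish, so [phantom y] is 0 there. *)
Lemma phantom_ninfty : phantom x @[x --> -oo] --> (0 : R).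
Proof.
apply/cvgrPdist_le => /= e e0; have q0 : 0 < (1 / 4 : R) by lra.
move/cvgrPdist_le : F_ninfty => /(_ _ q0); apply: filterS => y.
rewrite !sub0r !normrN => /(le_trans (ler_norm _)) hy.
rewrite ger0_norm ?geom_rate_ge0//; apply: le_trans (ltW e0).
apply: geom_rate_le => // n n0; rewrite clip_eq0 ?exprn_ge0//.
by apply: le_trans hy; exact: nexc_noninc.
Qed.

Lemma phantom_pinfty : phantom x @[x --> +oo] --> (1 : R).
Proof.
apply/cvgrPdist_le => /= e e0; have [delta d0 hd] := phantom_near1 e0.
move/cvgrPdist_le : F_pinfty => /(_ _ d0); apply: filterS => y.
move=> /(le_trans (ler_norm _)) /hd h.
have py : phantom y <= 1 by exact: geom_rate_le1.
by rewrite ger0_norm ?subr_ge0//; lra.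
Qed.

Let F_surj x : 0 < x < 1 -> exists u, F u = x.
Proof.
move=> /andP[x0 x1].
have x1' : 0 < 1 - x by rewrite subr_gt0.
have [a ha] : exists a, F a <= x.
  move/cvgrPdist_le : F_ninfty => /(_ _ x0) /filter_ex[a].
  by rewrite sub0r normrN => /(le_trans (ler_norm _)) h; exists a.
have [b hb] : exists b, x <= F b.
  move/cvgrPdist_le : F_pinfty => /(_ _ x1') /filter_ex[b].
  by move=> /(le_trans (ler_norm _)) h; exists b; lra.
have [ab|/ltW/F_le ba] := leP a b; last by exists a; apply/eqP; rewrite eq_le ha (le_trans hb).
have cF : {within `[a, b], continuous F} by exact: continuous_subspaceT.
have [|c _ Fc] := IVT (v := x) ab cF; last by exists c.
have Fab := F_le ab.
by rewrite min_l// max_r// ha.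
Qed.

(** Above a level [u0] with [F u0 = 1 - delta] the sequence is almost geometric. Below it,
    monotonicity bounds both terms by their values at [u0], which are at most [e] for large [n]. *)
Lemma phantom_close e : 0 < e ->
  exists N, forall n u, (N <= n)%N -> `|nexc X u n - phantom u ^+ n| <= e.
Proof.
move=> e0; have e20 : 0 < e / 2 by lra.
have [eta eta0 heta] := @geom_rate_close R _ e20.
have eta20 : 0 < eta / 2 by lra.
have [r hr] := nexc_mul stat mix eta20.
(* The second bound makes [2 r delta <= eta / 2], as [nexc_mul] requires, and [delta <= eta]; the
   first keeps [1 - delta] strictly between 0 and 1. *)
pose delta := Num.min (1 / 2) (eta / (4 * r%:R + 1)).
have r0 : 0 <= (r%:R : R) by [].
have D0 : 0 < 4 * r%:R + 1 :> R by rewrite ltr_wpDl// mulr_ge0.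
have d0 : 0 < delta by rewrite lt_min; apply/andP; split; [lra|exact: divr_gt0].
have d1 : delta <= 1 / 2 by rewrite ge_min lexx.
have d2 : (4 * r%:R + 1) * delta <= eta.
  by rewrite mulrC -ler_pdivlMr// /delta ge_min lexx orbT.
have d3 : 0 <= r%:R * delta by rewrite mulr_ge0// ltW.
have high u : 1 - F u <= delta -> forall n, `|nexc X u n - phantom u ^+ n| <= e / 2.
  move=> hu n; have [F1|F1] := ltP (F u) 1; last first.
    have nexc1 m : nexc X u m = 1.
      have Fu : nexc X u 1 = 1 by apply/eqP; rewrite eq_le F1 nexc_le1.
      apply/eqP; rewrite eq_le nexc_le1//=.
      by have := nexc_ge stat u m; rewrite Fu subrr mulr0 subr_le0.
    rewrite /phantom geom_rate_eq1 => [|m]; rewrite nexc1; last by lra.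
    by rewrite expr1n subrr normr0 ltW.
  have q0 : 0 < (1 / 4 : R) by lra.
  have [N hN] := nexc_to0 stat mix F1 q0.
  apply: heta hN n; split; first exact: nexc0.
  - exact: nexc_ge0.
  - exact: nexc_noninc.
  - move=> p q; apply: le_trans (hr u p q) _.
    have : r%:R * (1 - F u) <= r%:R * delta by rewrite ler_wpM2l.
    rewrite /F; lra.
  - by apply: le_trans hu _; lra.
have [u0 hu0] : exists u0, F u0 = 1 - delta by apply: F_surj; apply/andP; split; lra.
have F1 : F u0 < 1 by rewrite hu0; lra.
have [N hN] := nexc_to0 stat mix F1 e20.
exists N => n u Nn; have [u0u|/ltW uu0] := leP u0 u.
  apply: le_trans (high u _ n) _; last by lra.
  by have := F_le u0u; lra.
have h1 : nexc X u n <= nexc X u0 n by exact: nexc_mono.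
have h2 : phantom u ^+ n <= phantom u0 ^+ n.
  by apply: lerXn2r (phantom_nondecreasing uu0); rewrite nnegrE; exact: geom_rate_ge0.
have h3 : `|nexc X u0 n - phantom u0 ^+ n| <= e / 2.
  by apply: high; rewrite hu0 opprB addrC subrK.
have h4 := hN n Nn; have h5 := nexc_ge0 X u n.
have h6 : 0 <= phantom u ^+ n by apply: exprn_ge0; exact: geom_rate_ge0.
move: h1 h2 h3 h4 h5 h6.
move: (nexc X u n) (nexc X u0 n) (phantom u ^+ n) (phantom u0 ^+ n) => a b c g.
by rewrite !ler_norml => ? ? /andP[? ?] *; apply/andP; split; lra.
Qed.

Lemma phantom_cvg :
  ereal_sup [set (`|P [set w | (partial_max X n w <= u)%R] - (phantom u ^+ n)%:E|)%E
            | u in [set: R]] @[n --> \oo] --> 0%E.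
Proof.
have bnd e : 0 < e -> \forall n \near \oo, (0 <= ereal_sup
    [set (`|P [set w | (partial_max X n w <= u)%R] - (phantom u ^+ n)%:E|)%E
            | u in [set: R]] <= e%:E)%E.
  move=> e0; have [N hN] := phantom_close e0.
  (* The successor makes [n] positive, as [partial_max_le] demands. *)
  exists N.+1 => // n /= Nn; have n0 : (0 < n)%N by exact: leq_trans Nn.
  apply/andP; split.
    by apply: le_trans (ereal_sup_ubound _); last by exists 0.
  apply: ge_ereal_sup => _ [u _ <-].
  rewrite partial_max_le// probE; last exact: measurable_block.
  by rewrite -EFinB abse_EFin lee_fin; apply: hN; exact: ltnW.
apply/fine_cvgP; split.
  apply: filterS (bnd 1 ltr01) => n /andP[h0 h1].
  by rewrite ge0_fin_numE// (le_lt_trans h1)// ltry.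
apply/cvgrPdist_le => /= e e0; apply: filterS (bnd e e0) => n /andP[h0 h1].
rewrite sub0r normrN ger0_norm ?fine_ge0// -lee_fin fineK//.
by rewrite ge0_fin_numE// (le_lt_trans h1)// ltry.
Qed.

End Phantom.

Theorem theorem4p1 (d : measure_display) (T : measurableType d) (R : realType)
    (P : probability T R) (X : nat -> {RV P >-> R}) :
  strictly_stationary X ->
  alpha_mixing X ->
  continuous (fun x : R => fine (cdf (X 0%N) x)) ->
  exists G : cumulativeBounded (0 : R) (1 : R),
    continuous G /\ phantom_df X G.
Proof.
move=> stat mix cont.
have cG := continuous_phantom stat mix cont.
have rc : right_continuous (phantom X).
  by move=> x; apply: cvg_at_right_filter; exact: cG.
pose G := HB.pack_for (cumulativeBounded (0 : R) (1 : R)) (phantom X)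
  (isCumulative.Build R _ R _ (@phantom_nondecreasing _ _ _ _ X) rc)
  (isCumulativeBounded.Build R 0 1 _ (phantom_ninfty X) (phantom_pinfty stat)).
exists G; split; first exact: cG.
exact: phantom_cvg.
Qed.
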